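(* Fix a real number $q<0$. Then for every integer $n\ge 2$, \[ |\mathsf{S}^{\mathrm{pl}}_n(q)| \;\ge\; 2^{(n-2)/2}. \]
   Context: $P_G(x)$ denotes the chromatic polynomial of a finite graph $G$. $\mathsf{S}^{\mathrm{pl}}_n(q)\coloneqq\{P_G(q): G \text{ a simple planar graph on } n\text{ vertices}\}$. *)

(* Defs.v *)
From HB Require Import structures.
From mathcomp Require Import all_boot all_order all_algebra finmap.
From mathcomp Require Import all_classical all_reals all_analysis.

Set Implicit Arguments.
Unset Strict Implicit.
Unset Printing Implicit Defensive.

Import Order.TTheory GRing.Theory Num.Theory.
Import numFieldNormedType.Exports.

Local Open Scope classical_set_scope.
Local Open Scope ring_scope.

Record sgraph (n : nat) := SGraph {
  adj :> rel 'I_n;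
  adj_sym : symmetric adj;
  adj_irr : irreflexive adj }.

Definition proper_colorings (n : nat) (G : sgraph n) (k : nat) :
    {set {ffun 'I_n -> 'I_k}} :=
  [set f : {ffun 'I_n -> 'I_k} |
    [forall u, forall v, G u v ==> (f u != f v)]]%SET.

Definition counts_colorings (R : realType) (n : nat) (G : sgraph n)
    (p : {poly R}) : Prop :=
  forall k : nat, p.[k%:R] = #|proper_colorings G k|%:R.

(* Existence and uniqueness of such a polynomial are [chromatic_polyP] and
   [chromatic_poly_unique]; the default value 0 is never used. *)
Definition chromatic_poly (R : realType) (n : nat) (G : sgraph n) : {poly R} :=
  xget 0 [set p | counts_colorings G p].

Definition arc (R : realType) (x y : R * R) (A : set (R * R)) : Prop :=
  exists f : R -> R * R,
    [/\ {within `[0, 1], continuous f}, set_inj `[0, 1] f,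
        f 0 = x, f 1 = y & f @` `[0, 1] = A].

(* [p u] is the point representing the vertex u, and [A u v] is the arc
   representing the edge uv; the values of A on non-edges are irrelevant. *)
Definition plane_drawing (R : realType) (n : nat) (G : sgraph n)
    (p : 'I_n -> R * R) (A : 'I_n -> 'I_n -> set (R * R)) : Prop :=
  [/\ injective p,
      forall u v, G u v -> arc (p u) (p v) (A u v) /\ A u v = A v u,
      forall u v w, G u v -> A u v (p w) -> w = u \/ w = v
    & forall u v u' v', G u v -> G u' v' -> [set u; v]%SET != [set u'; v']%SET ->
        (A u v `\` [set p u; p v]) `&` A u' v' = set0].

Definition planar (R : realType) (n : nat) (G : sgraph n) : Prop :=
  exists p A, @plane_drawing R n G p A.

Definition planar_chromatic_values (R : realType) (n : nat) (q : R) : set R :=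
  [set x | exists G : sgraph n, planar R G /\ x = (chromatic_poly R G).[q]].

Section WellDefined.
Variables (R : realType) (n : nat).
Implicit Types G : sgraph n.

Let binp (j : nat) : {poly R} :=
  (j`!%:R)^-1 *: \prod_(i < j) ('X - i%:R%:P).

Let binpE j k : (binp j).[k%:R] = 'C(k, j)%:R.
Proof.
have fact_neq0 : (j`!%:R : R) != 0 by rewrite pnatr_eq0 -lt0n fact_gt0.
rewrite /binp hornerZ horner_prod.
apply: (mulfI fact_neq0); rewrite mulrA mulfV// mul1r -natrM mulnC bin_ffact.
rewrite ffact_prod.
have [jk|kj] := leqP j k.
  rewrite natr_prod; apply: eq_bigr => i _.
  by rewrite !hornerE natrB// (leq_trans (ltnW (ltn_ord i))).
rewrite (bigD1 (Ordinal kj))//= [in RHS](bigD1 (Ordinal kj))//=.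
by rewrite !hornerE subrr subnn mul0r mul0n.
Qed.

(* Colourings with k colours, sorted by the set of colours they use *)
Let onto G j : {set {ffun 'I_n -> 'I_j}} :=
  [set f in proper_colorings G j | f @: [set: 'I_n] == [set: 'I_j]]%SET.

Let card_image G k (B : {set 'I_k}) :
  #|[set f in proper_colorings G k | f @: [set: 'I_n] == B]%SET| =
  #|onto G #|B| |.
Proof.
pose h (g : {ffun 'I_n -> 'I_#|B|}) : {ffun 'I_n -> 'I_k} :=
  [ffun u => enum_val (g u)].
have h_inj : injective h.
  move=> g g' /ffunP gg'; apply/ffunP => u.
  by have := gg' u; rewrite !ffunE => /enum_val_inj.
rewrite -(card_imset _ h_inj); apply: eq_card => f.
apply/idP/imsetP => [|[g]].
  rewrite !inE => /andP[/forallP fP /eqP fB].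
  have inB u : f u \in B by rewrite -fB imset_f.
  exists [ffun u => enum_rank_in (inB u) (f u)]; last first.
    by apply/ffunP => u; rewrite !ffunE enum_rankK_in.
  rewrite !inE; apply/andP; split.
    apply/forallP => u; apply/forallP => v; apply/implyP => Guv.
    have /forallP/(_ v)/implyP/(_ Guv) := fP u.
    apply: contra; rewrite !ffunE => /eqP/(congr1 enum_val).
    by rewrite !enum_rankK_in// => ->.
  apply/eqP/setP => i; rewrite inE; apply/imsetP.
  have : enum_val i \in (f @: [set: 'I_n])%SET by rewrite fB; exact: enum_valP.
  move=> /imsetP[u _ iu]; exists u => //.
  by apply: enum_val_inj; rewrite ffunE enum_rankK_in.
rewrite !inE => /andP[/forallP gP /eqP gT] ->; apply/andP; split.
  apply/forallP => u; apply/forallP => v; apply/implyP => Guv.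
  have /forallP/(_ v)/implyP/(_ Guv) := gP u.
  by apply: contra; rewrite !ffunE => /eqP/enum_val_inj ->.
apply/eqP/setP => i; apply/imsetP/idP => [[u _ ->]|iB].
  by rewrite ffunE enum_valP.
have : enum_rank_in iB i \in [set: 'I_#|B|]%SET by rewrite inE.
rewrite -gT => /imsetP[u _ iu]; exists u => //.
by rewrite ffunE -iu enum_rankK_in.
Qed.

Let card_proper G k :
  #|proper_colorings G k| = (\sum_(j < n.+1) 'C(k, j) * #|onto G j|)%N.
Proof.
pose im (f : {ffun 'I_n -> 'I_k}) : {set 'I_k} := (f @: [set: 'I_n])%SET.
rewrite -sum1_card (partition_big im predT)//=.
transitivity (\sum_(B : {set 'I_k}) #|onto G #|B| |)%N.
  apply: eq_bigr => B _; rewrite -card_image -sum1_card.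
  by apply: eq_bigl => f; rewrite !inE.
have onto0 j : (n < j)%N -> #|onto G j| = 0%N.
  move=> nj; apply/eqP; rewrite cards_eq0; apply/eqP/setP => f.
  rewrite [in RHS]inE; apply/negP; rewrite inE => /andP[_ /eqP fT].
  have := leq_imset_card f [set: 'I_n]%SET.
  by rewrite fT !cardsT !card_ord leqNgt nj.
rewrite (bigID (fun B : {set 'I_k} => (#|B| < n.+1)%N))/= [X in (_ + X)%N]big1.
  rewrite addn0.
  rewrite (partition_big (fun B : {set 'I_k} => inord #|B| : 'I_n.+1) predT)//=.
  apply: eq_bigr => j _; rewrite -[in RHS](card_ord k) -card_draws -sum_nat_const.
  apply: eq_big => [B|B /andP[Bn /eqP <-]]; last by rewrite inordK.
  rewrite inE; apply/andP/eqP => [[Bn /eqP <-]|Bj]; first by rewrite inordK.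
  by rewrite Bj ltn_ord; split=> //; apply/eqP/val_inj; rewrite /= inordK.
by move=> B; rewrite -leqNgt => /onto0.
Qed.

Lemma chromatic_poly_unique G (p p' : {poly R}) :
  counts_colorings G p -> counts_colorings G p' -> p = p'.
Proof.
move=> hp hp'; apply/eqP; rewrite -subr_eq0; apply/negPn/negP => nz.
pose s := [seq i%:R : R | i <- iota 0 (size (p - p'))].
have : (size s < size (p - p')%R)%N.
  apply: max_poly_roots => //.
    by apply/allP => _ /mapP[i _ ->]; rewrite rootE !hornerE hp hp' subrr.
  by rewrite map_inj_uniq ?iota_uniq// => i j /eqP; rewrite eqr_nat => /eqP.
by rewrite size_map size_iota ltnn.
Qed.

Lemma chromatic_polyP G : counts_colorings G (chromatic_poly R G).
Proof.
rewrite /chromatic_poly; apply: (@xgetPex _ 0 [set p | counts_colorings G p]).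
exists (\sum_(j < n.+1) #|onto G j|%:R *: binp j) => k.
rewrite card_proper natr_sum horner_sum; apply: eq_bigr => j _.
by rewrite hornerZ binpE natrM mulrC.
Qed.

Lemma finite_planar_chromatic_values (q : R) :
  finite_set (planar_chromatic_values n q).
Proof.
Proof.
pose F (g : {ffun 'I_n * 'I_n -> bool}) : R := xget 0
  [set x | exists G : sgraph n,
     (forall u v, g (u, v) = G u v) /\ x = (chromatic_poly R G).[q]].
apply: (@sub_finite_set _ _ (F @` [set: {ffun 'I_n * 'I_n -> bool}])).
  move=> x [G [_ ->]]; exists [ffun e => G e.1 e.2] => //; rewrite /F.
  case: xgetP => [y _ [G' [GG' ->]]|/(_ (chromatic_poly R G).[q])[]].
    congr (_.[q]); apply: (@chromatic_poly_unique G); last exact: chromatic_polyP.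
    move=> k; rewrite chromatic_polyP; congr (_%:R); apply: eq_card => f.
    rewrite !inE; apply: eq_forallb => u; apply: eq_forallb => v.
    by rewrite -GG' ffunE.
  by exists G; split=> // u v; rewrite ffunE.
exact/finite_image/finite_finset.
Qed.

End WellDefined.

(* Main.v *)
(* A fan consists of an apex 0, a spine, which is a path, and leaves, each
   joined to the apex and to one spine vertex; building it vertex by vertex,
   each new vertex either extends the spine or is a leaf at the current spine
   end v. Let a and b count the colourings in which 0 and v receive distinct,
   respectively equal, colours. A leaf multiplies (a, b) by (q - 2, q - 1) and
   a spine step maps it to ((q - 2) a + (q - 1) b, a). For q < 0 the ratio
   t = - b / a lives in (0, 1 / (1 - q)], where the two steps act injectively,
   with images separated by the value 1 / (2 - q). Hence the 2 ^ (n - 2) fans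
   on n vertices have distinct pairs (a, b). Both a (the fan plus the edge
   joining 0 to v) and a + b (the fan) are chromatic values of planar graphs on
   n vertices, so the square of the number of values is at least 2 ^ (n - 2). *)
Require Import Defs.
From mathcomp Require Import all_boot all_order all_algebra finmap.
From mathcomp Require Import all_classical all_reals all_analysis.
From mathcomp Require Import ring lra zify.

Import Order.TTheory GRing.Theory Num.Theory.
Import numFieldNormedType.Exports.
Local Open Scope ring_scope.

(** * Fans, encoded by the set [S] of their spine vertices *)

Fixpoint last_spine (S : pred nat) (k : nat) : nat :=
  if k is k'.+1 then (if S k then k else last_spine S k') else 0%N.

Lemma last_spine_le (S : pred nat) k : (last_spine S k <= k)%N.
Proof. by elim: k => //= k IH; case: ifP => // _; exact: leqW. Qed.

Lemma last_spine_gt (S : pred nat) k l :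
  (last_spine S k < l <= k)%N -> ~~ S l.
Proof.
elim: k => [|k IH] /=; first by case: l.
case: ifPn => [_|Sk]; first by lia.
rewrite (leq_eqVlt l) => /andP[lk /orP[/eqP -> //|lk']].
by apply: IH; rewrite lk.
Qed.

(** The assumption [S 1] keeps the default value 0, which is the apex, from being returned as a
    spine end. *)
Lemma last_spineP (S : pred nat) k : S 1%N -> (0 < k)%N ->
  S (last_spine S k) /\ (0 < last_spine S k)%N.
Proof.
move=> S1; elim: k => //= k IH _; case: ifPn => // nSk.
by apply: IH; case: k nSk => //; rewrite S1.
Qed.

(** Each edge is listed at its larger end [j]. The guard [1 < j] makes every fan start from the apex
    0 and the spine vertex 1 without an edge between them. *)
Definition back_edge (S : pred nat) (i j : nat) : bool :=
  (1 < j)%N && ((i == last_spine S j.-1) || ((i == 0%N) && ~~ S j)).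

Definition closing_edge (S : pred nat) (n i j : nat) : bool :=
  (i == 0%N) && (j == last_spine S n.-1).

Definition fan_rel (S : pred nat) (n : nat) (closed : bool)
    (i j : nat) : bool :=
  (i < j)%N && (back_edge S i j || closed && closing_edge S n i j).

Lemma fan_rel_sym (S : pred nat) n c :
  symmetric (fun i j : 'I_n => fan_rel S n c i j || fan_rel S n c j i).
Proof. by move=> i j; rewrite orbC. Qed.

Lemma fan_rel_irr (S : pred nat) n c :
  irreflexive (fun i j : 'I_n => fan_rel S n c i j || fan_rel S n c j i).
Proof. by move=> i; rewrite /fan_rel ltnn. Qed.

Definition fan (S : pred nat) (n : nat) (closed : bool) : sgraph n :=
  SGraph (fan_rel_sym S n closed) (fan_rel_irr S n closed).

Definition spine_ord (S : pred nat) (n : nat) : 'I_n.+1 :=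
  inord (last_spine S n).

Lemma spine_ordE (S : pred nat) n : spine_ord S n = last_spine S n :> nat.
Proof. by rewrite inordK// ltnS last_spine_le. Qed.

Lemma proper_fanP (S : pred nat) n c k (f : {ffun 'I_n -> 'I_k}) :
  reflect (forall i j : 'I_n, fan_rel S n c i j -> f i != f j)
    (f \in proper_colorings (fan S n c) k).
Proof.
rewrite inE; apply: (iffP forallP) => [fP i j ij|fP i].
  by have /forallP/(_ j)/implyP := fP i; apply; rewrite /= ij.
apply/forallP => j; apply/implyP => /= /orP[/fP //|/fP].
by rewrite eq_sym.
Qed.

(** The closing edge turns the count a of colourings separating the apex from the spine end into a
    count of proper colourings of a graph. *)
Lemma proper_fan_closed (S : pred nat) n k (f : {ffun 'I_n.+2 -> 'I_k}) :
  S 1%N ->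
  (f \in proper_colorings (fan S n.+2 true) k) =
  (f \in proper_colorings (fan S n.+2 false) k)
    && (f ord0 != f (spine_ord S n.+1)).
Proof.
move=> S1; have [_ l0] := @last_spineP S n.+1 S1 isT.
apply/proper_fanP/andP => [fP|[/proper_fanP fP f0] i j].
  split.
    apply/proper_fanP => i j /andP[ij]; rewrite orbF => b.
    by apply: fP; rewrite /fan_rel ij b.
  by apply: fP; rewrite /fan_rel /closing_edge spine_ordE /= l0 eqxx /= orbT.
move=> /andP[ij /orP[b|/andP[_ /andP[/eqP i0 /eqP jl]]]].
  by apply: fP; rewrite /fan_rel ij b.
have -> : i = ord0 by apply: val_inj.
by have -> : j = spine_ord S n.+1 by apply: val_inj; rewrite /= spine_ordE.
Qed.

(** * Extending colourings by one vertex and counting them *)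

Definition ffext {T : Type} {n : nat} (g : {ffun 'I_n -> T}) (c : T) :
    {ffun 'I_n.+1 -> T} :=
  [ffun i => if unlift ord_max i is Some j then g j else c].

Lemma ffext_max {T : Type} {n : nat} (g : {ffun 'I_n -> T}) (c : T) :
  ffext g c ord_max = c.
Proof. by rewrite ffunE unlift_none. Qed.

Lemma ffext_lift {T : Type} {n : nat} (g : {ffun 'I_n -> T}) (c : T)
    (i : 'I_n) :
  ffext g c (lift ord_max i) = g i.
Proof. by rewrite ffunE liftK. Qed.

Lemma ffextE {T : Type} {n : nat} (g : {ffun 'I_n -> T}) (c : T)
    (i : 'I_n.+1) (j : 'I_n) : i = j :> nat -> ffext g c i = g j.
Proof.
move=> ij; have -> : i = lift ord_max j; last exact: ffext_lift.
by apply: ord_inj; rewrite lift_max.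
Qed.

Lemma sum_ffext {V : nmodType} {T : finType} {n : nat}
    (F : {ffun 'I_n.+1 -> T} -> V) :
  \sum_f F f = \sum_(g : {ffun 'I_n -> T}) \sum_(c : T) F (ffext g c).
Proof.
rewrite pair_big /=.
apply: (reindex (fun gc : {ffun 'I_n -> T} * T => ffext gc.1 gc.2)).
exists (fun f : {ffun 'I_n.+1 -> T} =>
  ([ffun i : 'I_n => f (lift ord_max i)], f ord_max)) => [[g c] _|f _] /=.
  rewrite ffext_max; congr pair; apply/ffunP => i.
  by rewrite ffunE ffext_lift.
apply/ffunP => i; rewrite ffunE.
by case: unliftP => [j ->|->]; rewrite ?ffunE.
Qed.

(** The new vertex has back edges only, so properness splits into that of [g] and conditions on the
    single colour [c]. *)
Lemma proper_fan_ext (S : pred nat) n k (g : {ffun 'I_n.+2 -> 'I_k}) c :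
  S 1%N ->
  (ffext g c \in proper_colorings (fan S n.+3 false) k) =
  [&& g \in proper_colorings (fan S n.+2 false) k,
      c != g (spine_ord S n.+1) & S n.+2 || (c != g ord0)].
Proof.
move=> S1.
have injE (i : 'I_n.+3) (lt_i : (i < n.+2)%N) : ffext g c i = g (Ordinal lt_i).
  exact: ffextE.
have spine_lt : (last_spine S n.+1 < n.+2)%N by rewrite ltnS last_spine_le.
apply/proper_fanP/and3P => [fP|[/proper_fanP gP cv c0] i j].
  have step (i : 'I_n.+2) : back_edge S i n.+2 -> c != g i.
    move=> b; rewrite eq_sym -(@ffext_max _ _ g c) -(ffext_lift g c i).
    by apply: fP; rewrite /fan_rel lift_max ltn_ord b.
  split.
  - apply/proper_fanP => i j ij; rewrite -!(ffext_lift g c); apply: fP.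
    by rewrite !lift_max.
  - by apply: step; rewrite /back_edge spine_ordE /= eqxx.
  - case: (boolP (S n.+2)) => //= nS.
    by apply: step; rewrite /back_edge /= nS orbT.
rewrite /fan_rel /= orbF => /andP[ij b].
have lt_i : (i < n.+2)%N by have := ltn_ord j; lia.
rewrite (injE _ lt_i).
have [lt_j|ge_j] := ltnP j n.+2.
  by rewrite (injE _ lt_j); apply: gP; rewrite /fan_rel /= ij b.
have jE : j = n.+2 :> nat by have := ltn_ord j; lia.
have -> : j = ord_max by apply: val_inj.
rewrite ffext_max eq_sym.
move: b; rewrite /back_edge jE /= => /orP[/eqP il|/andP[/eqP i0 nS]].
  suff -> : Ordinal lt_i = spine_ord S n.+1 by [].
  by apply: val_inj; rewrite /= spine_ordE.
have -> : Ordinal lt_i = ord0 by apply: val_inj.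
by move: c0; rewrite (negbTE nS).
Qed.

(** The pair (a, b) of the fan on [m.+2] vertices, whose last vertex is [m.+1]. An arbitrary ring
    allows evaluation both at numbers and at ['X]. *)
Fixpoint fan_pair {A : pzRingType} (S : pred nat) (x : A) (m : nat) : A * A :=
  if m is m'.+1 then
    let ab := fan_pair S x m' in
    if S m.+1 then ((x - 2) * ab.1 + (x - 1) * ab.2, ab.1)
    else ((x - 2) * ab.1, (x - 1) * ab.2)
  else (x * (x - 1), x).

Section Counting.
Context {R : realType}.

Lemma sum_neq {k} (x : 'I_k) : \sum_(c < k) (c != x)%:R = k%:R - 1 :> R.
Proof.
under eq_bigr => c _ do rewrite -[_%:R](addrK (c == x)%:R).
rewrite sumrB (eq_bigr (fun=> 1)) => [|c _]; last first.
  by case: (c == x); rewrite ?addr0 ?add0r.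
rewrite sumr_const card_ord (bigD1 x)//= eqxx big1 ?addr0// => c cx.
by rewrite (negbTE cx).
Qed.

Lemma sum_neq2 {k} (x y : 'I_k) : y != x ->
  \sum_(c < k) ((c != x) && (c != y))%:R = k%:R - 2 :> R.
Proof.
move=> yx; have -> : k%:R - 2 = \sum_(c < k) (c != x)%:R - 1 :> R.
  by rewrite sum_neq; ring.
rewrite [in RHS](bigD1 y)//= yx addrAC subrr add0r.
rewrite (bigD1 y)//= eqxx andbF add0r.
by apply: eq_bigr => c cy; rewrite cy andbT.
Qed.

Lemma sum_eq {k} (x : 'I_k) (P : pred 'I_k) :
  \sum_(c < k) (P c && (x == c))%:R = (P x)%:R :> R.
Proof.
rewrite (bigD1 x)//= eqxx andbT big1 ?addr0// => c cx.
by rewrite (eq_sym x) (negbTE cx) andbF.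
Qed.

Lemma fan_count (S : pred nat) (S1 : S 1%N) (k m : nat) :
  (\sum_(f : {ffun 'I_m.+2 -> 'I_k})
    ((f \in proper_colorings (fan S m.+2 false) k)
       && (f ord0 != f (spine_ord S m.+1)))%:R,
   \sum_(f : {ffun 'I_m.+2 -> 'I_k})
    ((f \in proper_colorings (fan S m.+2 false) k)
       && (f ord0 == f (spine_ord S m.+1)))%:R)
  = fan_pair S (k%:R : R) m.
Proof.
elim: m => [|m IH].
  have sp : spine_ord S 1%N = ord_max.
    by apply: val_inj; rewrite /= spine_ordE /= S1.
  have pr (g : {ffun 'I_1 -> 'I_k}) c :
      ffext g c \in proper_colorings (fan S 2 false) k.
    apply/proper_fanP => i j; rewrite /fan_rel /back_edge /=.
    by have := ltn_ord j; lia.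
  rewrite sp /=; congr pair; rewrite sum_ffext.
    under eq_bigr => g _ do under eq_bigr => c _ do
      rewrite pr /= ffext_max (ffextE g c ord0 ord0)// eq_sym.
    under eq_bigr => g _ do rewrite sum_neq.
    by rewrite sumr_const card_ffun !card_ord expn1 mulr_natl.
  under eq_bigr => g _ do under eq_bigr => c _ do
    rewrite pr /= ffext_max (ffextE g c ord0 ord0)//.
  under eq_bigr => g _ do rewrite (sum_eq (g ord0) xpredT).
  by rewrite sumr_const card_ffun !card_ord expn1.
(* The colour of the new vertex is summed out. [P] will be inequality, then equality, between the
   colours of the apex and of the new spine end, which is the new vertex or the old end. *)
have ext (P : rel 'I_k) :
    \sum_(f : {ffun 'I_m.+3 -> 'I_k})
      ((f \in proper_colorings (fan S m.+3 false) k)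
         && P (f ord0) (f (spine_ord S m.+2)))%:R =
    \sum_(g : {ffun 'I_m.+2 -> 'I_k} |
        g \in proper_colorings (fan S m.+2 false) k)
      \sum_(c < k) ([&& c != g (spine_ord S m.+1), S m.+2 || (c != g ord0)
        & P (g ord0) (if S m.+2 then c else g (spine_ord S m.+1))])%:R :> R.
  rewrite sum_ffext [RHS]big_mkcond; apply: eq_bigr => g _ /=.
  have spE c : ffext g c (spine_ord S m.+2) =
      if S m.+2 then c else g (spine_ord S m.+1).
    case: ifPn => [Sm|nSm]; last first.
      by apply: ffextE; rewrite !spine_ordE /= (negbTE nSm).
    have -> : spine_ord S m.+2 = ord_max; last exact: ffext_max.
    by apply: ord_inj; rewrite spine_ordE /= Sm.
  under eq_bigr => c _ do 
    rewrite spE (ffextE g c ord0 ord0)// proper_fan_ext// -!andbA.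
  by case: (g \in _); rewrite //= big1.
have weight (P : rel 'I_k) (x : R) :
    \sum_(f : {ffun 'I_m.+2 -> 'I_k})
      ((f \in proper_colorings (fan S m.+2 false) k)
         && P (f ord0) (f (spine_ord S m.+1)))%:R * x =
    \sum_(g : {ffun 'I_m.+2 -> 'I_k} |
        g \in proper_colorings (fan S m.+2 false) k)
      (P (g ord0) (g (spine_ord S m.+1)))%:R * x.
  rewrite [RHS]big_mkcond; apply: eq_bigr => g _.
  by case: (_ \in _) => //=; rewrite mul0r.
rewrite (ext (fun x y => x != y)) (ext (fun x y => x == y)) /= -IH /=.
(* The goals are a and b after a spine step, then a and b after a leaf. For b after a spine step the
   new colour is forced to be that of the apex. Otherwise it avoids those of the apex and the old
   spine end: k - 2 choices if these are distinct, k - 1 if equal. *)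
case: ifPn => [Sm|nSm] /=; congr pair.
- rewrite !(mulrC (k%:R - _)) !mulr_suml (weight (fun x y => x != y)).
  rewrite (weight (fun x y => x == y)) -big_split /=; apply: eq_bigr => g _.
  under eq_bigr => c _ do rewrite (eq_sym (g ord0)).
  have [->|ne] := eqVneq (g ord0) (g (spine_ord S m.+1)).
    under eq_bigr => c _ do rewrite andbb.
    by rewrite sum_neq mul0r mul1r add0r.
  by rewrite sum_neq2// mul0r mul1r addr0.
- rewrite [RHS](eq_bigr (fun g : {ffun 'I_m.+2 -> 'I_k} =>
    ((g \in proper_colorings (fan S m.+2 false) k)
       && (g ord0 != g (spine_ord S m.+1)))%:R * 1)) => [|g _]; last first.
    by rewrite mulr1.
  rewrite (weight (fun x y => x != y)); apply: eq_bigr => g _.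
  by rewrite mulr1 (sum_eq (g ord0) (fun c => c != g (spine_ord S m.+1))).
- rewrite mulrC mulr_suml (weight (fun x y => x != y)); apply: eq_bigr => g _.
  have [e|ne] := eqVneq (g ord0) (g (spine_ord S m.+1)).
    by rewrite mul0r big1// => c _; rewrite !andbF.
  under eq_bigr => c _ do rewrite andbT.
  by rewrite sum_neq2// mul1r.
- rewrite mulrC mulr_suml (weight (fun x y => x == y)); apply: eq_bigr => g _.
  have [->|ne] := eqVneq (g ord0) (g (spine_ord S m.+1)).
    under eq_bigr => c _ do rewrite andbT andbb.
    by rewrite sum_neq mul1r.
  by rewrite mul0r big1// => c _; rewrite !andbF.
Qed.

Lemma horner_fan_pair (S : pred nat) (x : R) m :
  fan_pair S x m = ((fan_pair S 'X m).1.[x], (fan_pair S 'X m).2.[x]).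
Proof.
elim: m => [|m IH] /=; first by rewrite !hornerE.
by rewrite IH; case: (S m.+2); rewrite /= !hornerE.
Qed.

(** Colourings are counted only for natural [k], so [fan_pair] is run at ['X]: uniqueness identifies
    the results with the chromatic polynomials, which can then be evaluated at [q]. *)
Lemma chromatic_fan (S : pred nat) (q : R) m : S 1%N ->
  (chromatic_poly R (fan S m.+2 true)).[q] = (fan_pair S q m).1 /\
  (chromatic_poly R (fan S m.+2 false)).[q] =
    (fan_pair S q m).1 + (fan_pair S q m).2.
Proof.
move=> S1.
have -> : chromatic_poly R (fan S m.+2 true) = (fan_pair S 'X m).1.
  apply: (chromatic_poly_unique (chromatic_polyP R (fan S m.+2 true))) => k.
  have -> : ((fan_pair S 'X m).1).[k%:R] = (fan_pair S k%:R m).1 :> R.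
    by rewrite horner_fan_pair.
  rewrite -fan_count//= -sum1_card natr_sum [RHS]big_mkcond.
  by apply: eq_bigr => f _; rewrite proper_fan_closed//; case: (_ && _).
have -> : chromatic_poly R (fan S m.+2 false) =
    (fan_pair S 'X m).1 + (fan_pair S 'X m).2.
  apply: (chromatic_poly_unique (chromatic_polyP R (fan S m.+2 false))) => k.
  have -> : ((fan_pair S 'X m).1 + (fan_pair S 'X m).2).[k%:R] =
      (fan_pair S k%:R m).1 + (fan_pair S k%:R m).2 :> R.
    by rewrite hornerD horner_fan_pair.
  rewrite -fan_count//= -sum1_card natr_sum [RHS]big_mkcond -big_split.
  apply: eq_bigr => f _ /=; case: (f \in _) => /=; last by rewrite addr0.
  by case: (_ == _); rewrite ?addr0 ?add0r.
by rewrite hornerD horner_fan_pair.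
Qed.

End Counting.

(** * The ratio - b / a as a code for the fan *)

Section Ratio.
Context {R : realFieldType}.

Fixpoint fan_ratio (S : pred nat) (q : R) (m : nat) : R :=
  if m is m'.+1 then
    let t := fan_ratio S q m' in
    if S m.+1 then (2 - q - (1 - q) * t)^-1 else t * ((1 - q) / (2 - q))
  else (1 - q)^-1.

(** In a spine step, (1 - q) t <= 1 keeps the denominator at least 1 - q; a leaf multiplies t by a
    factor in (0, 1). *)
Lemma fan_ratio_bound (S : pred nat) (q : R) m : q < 0 ->
  0 < fan_ratio S q m /\ (1 - q) * fan_ratio S q m <= 1.
Proof.
move=> q_lt0.
have q1 : 1 - q != 0 by rewrite lt0r_neq0//; lra.
have q2 : 2 - q != 0 by rewrite lt0r_neq0//; lra.
elim: m => [|m [IH0 IH1]] /=.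
  by rewrite invr_gt0 mulfV//; split; lra.
case: ifP => _.
  split; first by rewrite invr_gt0; lra.
  by rewrite ler_pdivrMr; lra.
split; first by rewrite mulr_gt0// divr_gt0//; lra.
have -> : (1 - q) * (fan_ratio S q m * ((1 - q) / (2 - q))) =
  (1 - q) * fan_ratio S q m * (1 - q) / (2 - q) by field.
by rewrite ler_pdivrMr; nra.
Qed.

(** A spine step has a denominator strictly below 2 - q because t > 0; a leaf gives at most 1 / (2 -
    q) because (1 - q) t <= 1. *)
Lemma fan_ratio_step (S : pred nat) (q : R) m : q < 0 ->
  S m.+2 = ((2 - q)^-1 < fan_ratio S q m.+1).
Proof.
move=> q_lt0.
have q2 : 2 - q != 0 by rewrite lt0r_neq0//; lra.
have [t0 t1] := fan_ratio_bound S q m q_lt0; rewrite /=; case: ifP => _.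
  have pt : 0 < (1 - q) * fan_ratio S q m by rewrite mulr_gt0//; lra.
  by rewrite ltf_pV2 ?posrE; lra.
rewrite mulrA ltr_pdivlMr ?mulVf//; last lra.
by apply/esym/negbTE; rewrite -leNgt mulrC.
Qed.

(** The steps are decoded from the end: the threshold reveals the last one, which is injective in t
    and can be undone. *)
Lemma fan_ratio_inj (S S' : pred nat) (q : R) m : q < 0 ->
  fan_ratio S q m = fan_ratio S' q m ->
  forall i, (i < m)%N -> S i.+2 = S' i.+2.
Proof.
move=> q_lt0.
have q1 : 1 - q != 0 by rewrite lt0r_neq0//; lra.
have q2 : 2 - q != 0 by rewrite lt0r_neq0//; lra.
elim: m => // m IH e i; rewrite ltnS => im.
have Sm : S m.+2 = S' m.+2 
  by rewrite (fan_ratio_step S q)// (fan_ratio_step S' q)// e.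
move: im; rewrite leq_eqVlt => /orP[/eqP -> //|]; apply: IH.
move: e; rewrite /= Sm; case: ifP => _.
  by move=> /invr_inj/addrI/oppr_inj; exact: mulfI.
by apply: mulIf; rewrite mulf_neq0// invr_eq0.
Qed.

(** After a spine step the new a is - (2 - q - (1 - q) t) a, nonzero by the bounds on t; hence both
    claims go through one induction. *)
Lemma fan_pair_ratio (S : pred nat) (q : R) m : q < 0 ->
  (fan_pair S q m).1 != 0 /\
  (fan_pair S q m).2 = - fan_ratio S q m * (fan_pair S q m).1.
Proof.
move=> q_lt0.
have q1 : 1 - q != 0 by rewrite lt0r_neq0//; lra.
have q2 : 2 - q != 0 by rewrite lt0r_neq0//; lra.
elim: m => [|m [IH0 IH]] /=.
  split; first by rewrite mulf_neq0 ?ltr0_neq0//; lra.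
  by field.
have [t0 t1] := fan_ratio_bound S q m q_lt0.
case: ifP => _ /=.
  have d0 : 2 - q - (1 - q) * fan_ratio S q m != 0.
    by rewrite lt0r_neq0//; lra.
  rewrite IH; have -> : (q - 2) * (fan_pair S q m).1 +
    (q - 1) * (- fan_ratio S q m * (fan_pair S q m).1) =
    - (2 - q - (1 - q) * fan_ratio S q m) * (fan_pair S q m).1 by ring.
  by split; [rewrite mulf_neq0// oppr_eq0 | field].
split; first by rewrite mulf_neq0// ltr0_neq0//; lra.
by rewrite IH; field.
Qed.

Lemma fan_pair_inj (S S' : pred nat) (q : R) m : q < 0 ->
  fan_pair S q m = fan_pair S' q m ->
  forall i, (i < m)%N -> S i.+2 = S' i.+2.
Proof.
move=> q_lt0 e i; apply: (fan_ratio_inj S S' q m q_lt0).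
have [a0 b] := fan_pair_ratio S q m q_lt0.
have [_ b'] := fan_pair_ratio S' q m q_lt0.
by apply/oppr_inj/(mulIf a0); rewrite -b e b'.
Qed.

End Ratio.

(** * Straight-line plane drawings of fans *)

Section Drawing.
Context {R : realType}.
Implicit Types x y z : (R * R)%type.

Definition segment_map x y (t : R) : (R * R)%type :=
  ((1 - t) * x.1 + t * y.1, (1 - t) * x.2 + t * y.2).

Definition segment x y : set (R * R) := (segment_map x y @` `[0, 1])%classic.

Lemma segment_sym x y : segment x y = segment y x.
Proof.
suff sub x' y' : (segment x' y' `<=` segment y' x')%classic.
  by apply/seteqP; split.
move=> z [t]; rewrite /= in_itv /= => /andP[t0 t1] <-.
exists (1 - t); first by rewrite /= in_itv /=; apply/andP; split; lra.
by rewrite /segment_map; congr pair; ring.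
Qed.

Lemma continuous_segment_map x y : continuous (segment_map x y).
Proof.
have cont (a b : R) : continuous (fun t : R => (1 - t) * a + t * b).
  move=> t; apply: cvgD; apply: cvgMr_tmp; last exact: cvg_id.
  by apply: cvgB; [exact: cvg_cst | exact: cvg_id].
move=> t; apply: (@cvg_pair _ _ _ (nbhs t)
  (nbhs (segment_map x y t).1) (nbhs (segment_map x y t).2)); exact: cont.
Qed.

Lemma arc_segment x y : x <> y -> Defs.arc x y (segment x y).
Proof.
move=> xy; exists (segment_map x y); split=> //.
- exact/continuous_subspaceT/continuous_segment_map.
- move=> s t _ _ [e1 e2]; apply: contrapT => /eqP st; apply: xy.
  have st0 : s - t != 0 by rewrite subr_eq0.
  rewrite (surjective_pairing x) (surjective_pairing y).
  congr pair; apply/eqP; rewrite -subr_eq0; apply/eqP/(mulfI st0); lra.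
- by rewrite /segment_map (surjective_pairing x) /=; congr pair; ring.
- by rewrite /segment_map (surjective_pairing y) /=; congr pair; ring.
Qed.

(* The apex [0] lies above the last spine vertex, so that the closing edge is
   vertical. *)
Definition fan_point (S : pred nat) (n k : nat) : (R * R)%type :=
  if k == 0%N then ((last_spine S n.-1)%:R, 2) else (k%:R, (~~ S k)%:R).

Lemma fan_point0 (S : pred nat) n :
  fan_point S n 0%N = ((last_spine S n.-1)%:R, 2).
Proof. by []. Qed.

Lemma fan_point_gt0 (S : pred nat) n k : (0 < k)%N ->
  fan_point S n k = (k%:R, (~~ S k)%:R).
Proof. by case: k. Qed.

(** Edges avoiding the apex. They are drawn at heights between 0 and 1, with spine vertices at
    height 0 and leaves at height 1. *)
Definition lower_edge (S : pred nat) (i j : nat) : Prop :=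
  [/\ (0 < i < j)%N, S i & forall l, (i < l < j)%N -> ~~ S l].

(** Edges at the apex. Those to leaves are drawn at heights between 1 and 2; only the vertical
    closing edge goes below. *)
Definition upper_edge (S : pred nat) (n i j : nat) : Prop :=
  [/\ i = 0%N, (0 < j)%N & ~~ S j \/ j = last_spine S n.-1].

Lemma fan_relP (S : pred nat) n c i j : S 1%N -> fan_rel S n c i j ->
  lower_edge S i j \/ upper_edge S n i j.
Proof.
move=> S1 /andP[ij /orP[/andP[j1 /orP[/eqP il|/andP[/eqP i0 nS]]]|]].
- left; have [Si i0] : S i /\ (0 < i)%N.
    by rewrite il; apply: last_spineP => //; lia.
  split=> //; first by rewrite i0.
  by move=> l /andP[il' lj]; apply: (@last_spine_gt S j.-1); rewrite -il; lia.
- by right; split=> //; [lia | left].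
- by move=> /andP[_ /andP[/eqP i0 /eqP jl]]; right; split=> //; [lia | right].
Qed.

Lemma lower_edge_point (S : pred nat) n i j z : lower_edge S i j ->
  segment (fan_point S n i) (fan_point S n j) z ->
  [/\ i%:R <= z.1 <= j%:R, 0 <= z.2 <= (~~ S j)%:R
    & z.2 * (j%:R - i%:R) = (z.1 - i%:R) * (~~ S j)%:R].
Proof.
move=> [/andP[i0 ij] Si _] [t]; rewrite /= in_itv /= => /andP[t0 t1] <-.
rewrite !fan_point_gt0//; last exact: ltn_trans ij.
rewrite /segment_map Si /=; have ijR : i%:R < j%:R :> R by rewrite ltr_nat.
by split; [apply/andP; split; nra| |ring]; case: (S j) => /=;
  apply/andP; split; lra.
Qed.

(** Expressing the abscissa through the height also covers the vertical edge, where the right side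
    vanishes. *)
Lemma upper_edge_point (S : pred nat) n i j z : upper_edge S n i j ->
  segment (fan_point S n i) (fan_point S n j) z ->
  [/\ (j != last_spine S n.-1)%:R <= z.2 <= 2
    & z.1 - (last_spine S n.-1)%:R =
      (j%:R - (last_spine S n.-1)%:R) * (2 - z.2)].
Proof.
move=> [-> j0 Sj] [t]; rewrite /= in_itv /= => /andP[t0 t1] <-.
rewrite fan_point0 fan_point_gt0// /segment_map /=.
have [->|ne] := eqVneq j (last_spine S n.-1).
  split=> /=; last by ring.
  by case: (S _) => /=; apply/andP; split; lra.
have -> : ~~ S j by case: Sj => // jm; rewrite jm eqxx in ne.
by split=> /=; [apply/andP; split; lra|ring].
Qed.


Lemma fan_point_inj (S : pred nat) n (i j : nat) :
  fan_point S n i = fan_point S n j -> i = j.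
Proof.
case: (posnP i) (posnP j) => [->|i0] [->|j0] //.
- rewrite fan_point0 fan_point_gt0// => -[_].
  by case: (S j) => /= *; exfalso; lra.
- rewrite fan_point0 fan_point_gt0// => -[_].
  by case: (S i) => /= *; exfalso; lra.
- by rewrite !fan_point_gt0// => -[/eqP]; rewrite eqr_nat => /eqP.
Qed.

(** A vertex strictly between [i] and [j] is a leaf at height 1, while the segment stays below
    height 1 before reaching [j]. *)
Lemma lower_edge_vertex (S : pred nat) n i j k : lower_edge S i j ->
  segment (fan_point S n i) (fan_point S n j) (fan_point S n k) ->
  k = i \/ k = j.
Proof.
move=> lowij /(lower_edge_point _ _ _ _ _ lowij).
case: lowij => /andP[i0 ij] Si btw.
have ijR : i%:R < j%:R :> R by rewrite ltr_nat.
have [->|k0] := posnP k.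
  rewrite fan_point0 => -[_ /andP[_]].
  by case: (S j) => /= *; exfalso; lra.
rewrite fan_point_gt0//= !ler_nat => -[/andP[ik kj] _ e].
have [->|ki] := eqVneq k i; first by left.
have [->|kj'] := eqVneq k j; first by right.
have kjR : k%:R < j%:R :> R by rewrite ltr_nat; lia.
have ikR : i%:R < k%:R :> R by rewrite ltr_nat; lia.
have Sk : ~~ S k by apply: btw; lia.
by move: e; rewrite Sk; case: (S j) => /= *; exfalso; lra.
Qed.

Lemma upper_edge_vertex (S : pred nat) n i j k : upper_edge S n i j ->
  segment (fan_point S n i) (fan_point S n j) (fan_point S n k) ->
  k = i \/ k = j.
Proof.
move=> upij /(upper_edge_point _ _ _ _ _ upij).
case: upij => -> j0 _.
have [->|k0] := posnP k; first by left.
rewrite fan_point_gt0//= => -[/andP[y0 _] e]; right.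
apply/eqP; rewrite -(eqr_nat R); apply/eqP; move: y0 e.
have [->|ne] := eqVneq j (last_spine S n.-1); first by move=> _; lra.
by case: (S k) => /=; lra.
Qed.

Lemma lower_lower_crossing (S : pred nat) n i j i' j' z :
  lower_edge S i j -> lower_edge S i' j' -> (j < j')%N ->
  segment (fan_point S n i) (fan_point S n j) z ->
  segment (fan_point S n i') (fan_point S n j') z ->
  (z = fan_point S n i \/ z = fan_point S n j) /\
  (z = fan_point S n i' \/ z = fan_point S n j').
Proof.
move=> lowij lowij' jj'.
move=> /(lower_edge_point _ _ _ _ _ lowij)[/andP[xi xj] y01 e].
move=> /(lower_edge_point _ _ _ _ _ lowij')[/andP[xi' _] _ e'].
case: lowij => /andP[i0 ij] Si btw; case: lowij' => /andP[i0' ij'] Si' btw'.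
have j0 : (0 < j)%N by exact: leq_ltn_trans ij.
have ijR : i%:R < j%:R :> R by rewrite ltr_nat.
have jjR : j%:R < j'%:R :> R by rewrite ltr_nat.
(* Otherwise the spine vertex [i] would lie strictly between [i'] and [j']. *)
have ii' : (i <= i')%N.
  rewrite leqNgt; apply/negP => i'i.
  by have := btw' i; rewrite i'i (ltn_trans ij jj') Si => /(_ isT).
(* If [j <= i'], the ranges of abscissas can meet only at [j = i'], a spine vertex at height 0. *)
have [ji'|i'j] := leqP j i'.
  have ji'R : j%:R <= i'%:R :> R by rewrite ler_nat.
  have -> : i' = j by apply/eqP; rewrite -(eqr_nat R); apply/eqP; lra.
  have Sj : S j.
    suff -> : j = i' by [].
    by apply/eqP; rewrite -(eqr_nat R); apply/eqP; lra.
  suff -> : z = fan_point S n j by split; [right | left].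
  rewrite fan_point_gt0//.
  rewrite (surjective_pairing z) Sj; congr pair; first lra.
  by move: y01; rewrite Sj /= => /andP[]; lra.
(* Otherwise both segments start at the same spine vertex and [j] is a leaf before [j'], so the
   slopes differ. *)
have E : i' = i.
  apply/eqP; rewrite eqn_leq ii' andbT leqNgt; apply/negP => ii.
  by have := btw i'; rewrite ii i'j Si' => /(_ isT).
rewrite E in xi' e' *.
suff -> : z = fan_point S n i by split; left.
have Sj : ~~ S j by apply: btw'; rewrite i'j.
rewrite fan_point_gt0//.
rewrite (surjective_pairing z) Si /=.
rewrite Sj /= in e.
have y0 : z.2 = 0.
  move: e'; case: (S j') => /= e'.
    have : z.2 * (j'%:R - i%:R) = 0 by lra.
    by move=> /eqP; rewrite mulf_eq0 => /orP[/eqP //|/eqP]; lra.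
  have : z.2 * (j'%:R - j%:R) = 0 by lra.
  by move=> /eqP; rewrite mulf_eq0 => /orP[/eqP //|/eqP]; lra.
by rewrite y0; congr pair; move: e; rewrite y0; lra.
Qed.

Lemma lower_upper_crossing (S : pred nat) n i j i' j' z : S 1%N -> (j < n)%N ->
  lower_edge S i j -> upper_edge S n i' j' ->
  segment (fan_point S n i) (fan_point S n j) z ->
  segment (fan_point S n i') (fan_point S n j') z ->
  (z = fan_point S n i \/ z = fan_point S n j) /\
  (z = fan_point S n i' \/ z = fan_point S n j').
Proof.
move=> S1 jn lowij upij'.
have [Sm m0] : S (last_spine S n.-1) /\ (0 < last_spine S n.-1)%N.
  by apply: last_spineP => //; case: lowij => /andP[i0 ij] _ _; lia.
move=> /(lower_edge_point _ _ _ _ _ lowij)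
  [/andP[xi xj] /andP[y0 y1] e].
move=> /(upper_edge_point _ _ _ _ _ upij')[/andP[u0 u1] e'].
case: lowij => /andP[i0 ij] Si btw; case: upij' => _ j'0 Sj'.
have ijR : i%:R < j%:R :> R by rewrite ltr_nat.
(* An edge from the apex to a leaf stays at height at least 1 and a lower edge at height at most 1,
   so they meet only in a common leaf. *)
have [j'm|ne] := eqVneq j' (last_spine S n.-1); last first.
  have nSj' : ~~ S j' by case: Sj' => // jm; rewrite jm eqxx in ne.
  move: u0; rewrite ne /= => u0.
  have nSj : ~~ S j by move: y1; case: (S j) => //= *; exfalso; lra.
  rewrite nSj /= in y1 e.
  have y : z.2 = 1 by lra.
  rewrite y in e e'.
  have -> : j = j' by apply/eqP; rewrite -(eqr_nat R); apply/eqP; lra.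
  suff -> : z = fan_point S n j' by split; right.
  rewrite fan_point_gt0//.
  by rewrite (surjective_pairing z) nSj' y; congr pair; lra.
(* The closing edge is vertical above the spine vertex [j'], which cannot lie strictly between [i]
   and [j]. *)
rewrite -j'm in e' Sm m0.
have x : z.1 = j'%:R by lra.
rewrite x in xi xj e; rewrite !ler_nat in xi xj.
suff [y jj] : z.2 = 0 /\ (i = j' \/ j = j').
  have -> : z = fan_point S n j'.
    rewrite fan_point_gt0//.
    by rewrite (surjective_pairing z) Sm x y.
  by split; [case: jj => ->; [left|right] | right].
have [ji|ji] := eqVneq j' i.
  split; last by left.
  rewrite ji subrr mul0r in e.
  by move/eqP: e; rewrite mulf_eq0 => /orP[/eqP //|/eqP]; lra.
have jj : j = j'.
  apply/eqP; rewrite eqn_leq xj andbT leqNgt; apply/negP => lt.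
  by have := btw j'; rewrite Sm; lia.
split; last by right.
by move: y1; rewrite jj Sm /=; lra.
Qed.

(** Subtracting the two line equations gives (j - j') (2 - y) = 0 for the height y, so only the apex
    is shared. *)
Lemma upper_upper_crossing (S : pred nat) n i j i' j' z :
  upper_edge S n i j -> upper_edge S n i' j' -> j != j' ->
  segment (fan_point S n i) (fan_point S n j) z ->
  segment (fan_point S n i') (fan_point S n j') z ->
  (z = fan_point S n i \/ z = fan_point S n j) /\
  (z = fan_point S n i' \/ z = fan_point S n j').
Proof.
move=> upij upij' jj'.
move=> /(upper_edge_point _ _ _ _ _ upij)[_ e].
move=> /(upper_edge_point _ _ _ _ _ upij')[_ e'].
case: upij => -> j0 _; case: upij' => -> j0' _.
suff -> : z = fan_point S n 0 by split; left.
have jjR : (j%:R - j'%:R : R) != 0 by rewrite subr_eq0 eqr_nat.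
have y : z.2 = 2.
  have : (j%:R - j'%:R : R) * (2 - z.2) = 0 by lra.
  by move=> /eqP; rewrite mulf_eq0 (negbTE jjR) /= => /eqP; lra.
rewrite fan_point0 (surjective_pairing z) y; congr pair.
by move: e; rewrite y; lra.
Qed.

Lemma fan_crossing (S : pred nat) n c i j i' j' z : S 1%N ->
  (j < n)%N -> (j' < n)%N -> fan_rel S n c i j -> fan_rel S n c i' j' ->
  (i, j) != (i', j') ->
  segment (fan_point S n i) (fan_point S n j) z ->
  segment (fan_point S n i') (fan_point S n j') z ->
  z = fan_point S n i \/ z = fan_point S n j.
Proof.
move=> S1 jn jn' /(fan_relP _ _ _ _ _ S1) [lowij|upij];
  move=> /(fan_relP _ _ _ _ _ S1) [lowij'|upij'] ne zij zij'.
- have [jj'|jj'|jj'] := ltngtP j j'.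
  + by case: (lower_lower_crossing S n i j i' j' z).
  + by case: (lower_lower_crossing S n i' j' i j z).
  (* Both starts are spine vertices and neither lies strictly between the other and the common end,
     so they coincide. *)
  + case/negP: ne; rewrite jj' xpair_eqE eqxx andbT.
    case: lowij lowij' => /andP[i0 ij] Si btw [/andP[i0' ij'] Si' btw'].
    apply/eqP; have := btw i'; have := btw' i; rewrite Si Si'; lia.
- by case: (lower_upper_crossing S n i j i' j' z).
- by case: (lower_upper_crossing S n i' j' i j z).
- case: (upper_upper_crossing S n i j i' j' z) => //.
  by apply: contra ne => /eqP ->; case: upij upij' => -> _ _ [-> _ _].
Qed.

Lemma planar_fan (S : pred nat) n c : S 1%N -> planar R (fan S n c).
Proof.
move=> S1; pose p (u : 'I_n) := fan_point S n u.
pose A (u v : 'I_n) := segment (p u) (p v).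
have p_inj : injective p.
  by move=> u v e; apply: val_inj; exact: (fan_point_inj S n).
exists p, A; split=> //.
- move=> u v uv; split; last exact: segment_sym.
  by apply: arc_segment => /p_inj e; move: uv; rewrite e adj_irr.
(* [fan_rel] orients edges from the smaller vertex to the larger; symmetry of segments gives the
   other orientations. *)
- have vertex (u v w : 'I_n) :
      fan_rel S n c u v -> A u v (p w) -> w = u \/ w = v.
    move=> /(fan_relP _ _ _ _ _ S1) uv Auvw.
    have : (w = u :> nat) \/ (w = v :> nat).
      case: uv => uv; first exact: (lower_edge_vertex S n u v w).
      exact: (upper_edge_vertex S n u v w).
    by case=> /val_inj ->; [left | right].
  move=> u v w /orP[uv|vu]; first exact: vertex.
  by rewrite /A segment_sym => /(vertex _ _ _ vu) [|]; [right | left].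
- have crossing (u v u' v' : 'I_n) z : fan_rel S n c u v ->
      fan_rel S n c u' v' -> [set u; v]%SET != [set u'; v']%SET ->
      A u v z -> A u' v' z -> z = p u \/ z = p v.
    move=> uv uv' ne; apply: (fan_crossing S n c u v u' v' z) => //.
    by apply: contra ne => /eqP[/val_inj -> /val_inj ->].
  move=> u v u' v' /orP[uv|vu] /orP[uv'|vu'] ne;
    apply/seteqP; split=> // z [[Auv]].
  + by move=> nz Auv'; apply: nz; exact: (crossing u v u' v').
  + rewrite /A segment_sym => nz Auv'; apply: nz.
    by apply: (crossing u v v' u') => //; rewrite [X in _ != X]finset.setUC.
  + move=> nz Auv'; apply: nz; rewrite /A segment_sym in Auv; apply/or_comm.
    by apply: (crossing v u u' v') => //; rewrite [X in X != _]finset.setUC.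
  + rewrite /A segment_sym in Auv *; rewrite /A segment_sym => nz Auv'.
    apply: nz; apply/or_comm.
    apply: (crossing v u v' u') => //.
    by rewrite [X in X != _]finset.setUC [X in _ != X]finset.setUC.
Qed.

End Drawing.

(** * Fans coded by binary words and the bound on the number of values *)

Definition word_spine (w : seq bool) : pred nat :=
  fun k => nth true [:: true, true & w] k.

Lemma card_planar_values_sqr {R : realType} (q : R) (m : nat) : q < 0 ->
  (2 ^ m <= #|` fset_set (planar_chromatic_values m.+2 q)| ^ 2)%N.
Proof.
move=> q_lt0; set V := fset_set _.
have inV c (w : seq bool) :
    (chromatic_poly R (fan (word_spine w) m.+2 c)).[q] \in V.
  rewrite in_fset_set; last exact: finite_planar_chromatic_values.
  apply/mem_set; exists (fan (word_spine w) m.+2 c); split=> //.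
  exact: planar_fan.
(* Letter [i] of [w] decides whether vertex [i.+2] extends the spine. The two values are a and a +
   b, which determine (a, b). *)
pose F (w : m.-tuple bool) :=
  ((chromatic_poly R (fan (word_spine w) m.+2 true)).[q],
   (chromatic_poly R (fan (word_spine w) m.+2 false)).[q]).
have F_inj : injective F.
  move=> w w' [].
  have [-> ->] := chromatic_fan (word_spine w) q m isT.
  have [-> ->] := chromatic_fan (word_spine w') q m isT.
  move=> e1 e2; apply/val_inj/(@eq_from_nth _ true); rewrite !size_tuple//.
  move=> i im.
  have e : fan_pair (word_spine w) q m = fan_pair (word_spine w') q m.
    move: e2; rewrite e1 => /addrI e2.
    by rewrite (surjective_pairing (fan_pair _ _ _)) e1 e2 -surjective_pairing.
  exact: (fan_pair_inj _ _ q m q_lt0 e i im).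
have -> : (2 ^ m = size (map F (enum {: m.-tuple bool})))%N.
  by rewrite size_map -cardE card_tuple card_bool.
have -> : (#|` V| ^ 2 = size [seq (x, y) | x <- V, y <- V])%N.
  by rewrite size_allpairs -mulnn.
apply: uniq_leq_size; first by rewrite map_inj_uniq ?enum_uniq.
by move=> _ /mapP[w _ ->]; apply: allpairs_f; exact: inV.
Qed.

Theorem theorem2p12 (R : realType) (q : R) (hq : q < 0) (n : nat) (hn : (2 <= n)%N) :
  (2 : R) `^ ((n%:R - 2) / 2) <= #|` fset_set (planar_chromatic_values n q)|%:R.
Proof.
case: n hn => [//|[//|m]] _.
have -> : (m.+2%:R - 2 : R) = m%:R by rewrite -[m.+2]addn2 natrD; ring.
(* Squaring removes the half in the exponent and leaves an inequality between natural numbers. *)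
rewrite -(@ler_pXn2r _ 2)// ?nnegrE ?powR_ge0//.
rewrite -powR_mulrn ?powR_ge0// -powRrM divfK// powR_mulrn//.
by rewrite -!natrX ler_nat card_planar_values_sqr.
Qed.
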